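(* Let $(K(x)|K,v)$ be an extension of valued fields such that the approximation type $\mathrm{appr}(x,K)$ is immediate, and let $\mathbf d$ be the degree of $\mathrm{appr}(x,K)$. Let $f\in K[X]$ be a nonconstant polynomial of degree at most $\mathbf d$. Then $$[K(x)^h:K(f(x))^h]\;\leq\;\mathbf h_K(x:f).$$
   Context: Valuations are Krull valuations written additively; $vK$ is the value group and $Kv$ the residue field of $(K,v)$. $(L|K,v)$ denotes an extension of valued fields. An extension of $v$ to the algebraic closure of $K(x)$ is fixed, and $E^h$ denotes the henselization, inside this algebraic closure, of an intermediate field $E$. For $\alpha\in vK\cup\{\infty\}$ put $\mathrm{appr}(x,K)_\alpha=\{c\in K\mid v(x-c)\geq\alpha\}$. The approximation type of $x$ over $K$ is $\mathrm{appr}(x,K)=\{\mathrm{appr}(x,K)_\alpha\mid \alpha\in S\}$, where $S$, called its support, is the set of all $\alpha\in vK\cup\{\infty\}$ with $\mathrm{appr}(x,K)_\alpha\neq\emptyset$ (an initial segment). It is called immediate if $\bigcap_{\alpha\in S}\mathrm{appr}(x,K)_\alpha=\emptyset$; equivalently, $\{v(x-c)\mid c\in K\}$ has no maximal element. ''$\varphi(c)$ for $c\nearrow x$'' means: there is $\alpha\in vK$ with $\mathrm{appr}(x,K)_\alpha\ne\emptyset$ such that $\varphi(c)$ holds for all $c\in\mathrm{appr}(x,K)_\alpha$. $\mathrm{appr}(x,K)$ fixes the value of $g\in K[X]$ if there is $\alpha\in vK\cup\{\infty\}$ with $vg(c)=\alpha$ for $c\nearrow x$. The degree $\mathbf d$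 of an immediate $\mathrm{appr}(x,K)$ is the least degree of a polynomial in $K[X]$ whose value it does not fix, and $\mathbf d=\infty$ if it fixes the value of every polynomial. For $f=\sum_j c_jX^j$ of degree $n$, the $i$-th formal derivative is $f_i(X)=\sum_{j=i}^n\binom{j}{i}c_jX^{j-i}$. If $1\le n\leq\mathbf d$, then for $1\leq i\leq n$ the value of $f_i$ is fixed; $\beta_i$ denotes the fixed value $vf_i(c)$ for $c\nearrow x$ (with $\beta_i=\infty$ if $f_i=0$). The relative approximation degree $\mathbf h=\mathbf h_K(x:f)$ is the unique integer with $1\le\mathbf h\le n$ such that $\beta_{\mathbf h}+\mathbf h\cdot v(x-c)<\beta_i+i\cdot v(x-c)$ for all $i\neq\mathbf h$, $1\le i\le n$, for $c\nearrow x$ (such an integer exists). *)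

(* Defs.v *)
From HB Require Import structures.
From mathcomp Require Import all_boot all_order all_algebra.
From mathcomp Require Import boolp classical_sets.

Set Implicit Arguments.
Unset Strict Implicit.
Unset Printing Implicit Defensive.

Import Order.TTheory GRing.Theory Num.Theory.
Local Open Scope classical_set_scope.
Local Open Scope ring_scope.

(* A porderZmodType does not relate its order to its addition. *)
Record orderedGroup := OrderedGroup {
  orderedGroup_sort :> porderZmodType;
  orderedGroup_total : total (<=%R : rel orderedGroup_sort);
  orderedGroup_leD2r : forall z x y : orderedGroup_sort,
    x <= y -> x + z <= y + z
}.

(* G together with a largest, absorbing element, represented by None. *)
Definition extended_group (G : Type) := option G.
Notation infty := (None : extended_group _).

Section ExtendedGroup.
Context {G : porderZmodType}.
Implicit Types x y z : extended_group G.

HB.instance Definition _ := Choice.copy (extended_group G) (option G).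

Definition eg_add x y : extended_group G :=
  if x is Some a then if y is Some b then Some (a + b) else None else None.

Definition eg_le x y : bool :=
  if y is Some b then if x is Some a then a <= b else false else true.

Fact eg_addA : associative eg_add.
Proof. by case=> [a|] [b|] [c|] //=; rewrite addrA. Qed.

Fact eg_addC : commutative eg_add.
Proof. by case=> [a|] [b|] //=; rewrite addrC. Qed.

Fact eg_add0 : left_id (Some 0 : extended_group G) eg_add.
Proof. by case=> [a|] //=; rewrite add0r. Qed.

HB.instance Definition _ :=
  GRing.isNmodule.Build (extended_group G) eg_addA eg_addC eg_add0.

Fact eg_le_refl : reflexive eg_le.
Proof. by case=> [a|] /=. Qed.

Fact eg_le_anti : antisymmetric eg_le.
Proof. by case=> [a|] [b|] //= /le_anti ->. Qed.

Fact eg_le_trans : transitive eg_le.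
Proof. by case=> [b|] [a|] [c|] //=; apply: le_trans. Qed.

HB.instance Definition _ :=
  Order.isPOrder.Build ring_display (extended_group G)
    (fun _ _ => erefl) eg_le_refl eg_le_anti eg_le_trans.

End ExtendedGroup.

Fact eg_le_total (G : orderedGroup) :
  total (<=%R : rel (extended_group G)).
Proof. by case=> [a|] [b|] //; apply: (@orderedGroup_total G). Qed.

HB.instance Definition _ (G : orderedGroup) :=
  Order.POrder_isTotal.Build ring_display (extended_group G)
    (@eg_le_total G).

(* Krull valuations, written additively.  They need not be surjective: the
   value group of a subfield is its image inside G. *)
Record valuation (F : fieldType) (G : orderedGroup) := Valuation {
  valuation_fun :> F -> extended_group G;
  valuation_eq_infty : forall a, valuation_fun a = infty <-> a = 0;
  valuationM : forall a b,
    valuation_fun (a * b) = valuation_fun a + valuation_fun b;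
  valuationD : forall a b,
    Num.min (valuation_fun a) (valuation_fun b) <= valuation_fun (a + b)
}.

Section Subfields.
Context {F : fieldType}.
Implicit Types E L : set F.

Definition subfield E : Prop := GRing.divring_closed (mem E).

(* [L : E] = m, i.e. L has a basis with m elements over E. *)
Definition extension_degree E L (m : nat) : Prop :=
  exists e : 'I_m -> F, (forall i, L (e i)) /\
    forall y, L y ->
      exists! a : {ffun 'I_m -> F},
        (forall i, E (a i)) /\ y = \sum_i a i * e i.

Definition algebraic_over E : Prop :=
  forall y : F, exists p : {poly F},
    [/\ p != 0, forall i, E p`_i & root p y].

Definition adjoin (K : fieldType) (iota : {rmorphism K -> F}) (x : F) : set F :=
  smallest subfield (range iota `|` [set x]).

Section Henselization.
Context {G : orderedGroup}.
Variable v : valuation F G.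

(* Hensel's Lemma for the restriction of v to E. *)
Definition henselian E : Prop :=
  forall (p : {poly F}) (a : F),
    (forall i, E p`_i /\ 0 <= v p`_i :> extended_group G) ->
    E a -> 0 <= v a :> extended_group G ->
    0 < v p.[a] :> extended_group G -> v p^`().[a] = 0 ->
    exists b, [/\ E b, root p b & 0 < v (b - a) :> extended_group G].

(* The root b above is unique in F, so intersections of henselian subfields
   are henselian and this is the least henselian subfield of F containing E.
   It is the henselization of E provided F is an algebraic closure of E. *)
Definition henselization E : set F :=
  smallest [set H | subfield H /\ henselian H] E.

End Henselization.
End Subfields.

Section ApproximationTypes.
Context {K L : fieldType} {G : orderedGroup}.
Variables (iota : {rmorphism K -> L}) (v : valuation L G) (x : L).

(* The value group vK and the set vK together with infinity. *)
Definition value_group : set (extended_group G) :=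
  [set v (iota c) | c in [set c : K | c != 0]].
Definition values : set (extended_group G) := value_group `|` [set infty].

Definition appr (alpha : extended_group G) : set K :=
  [set c | alpha <= v (x - iota c)].

Definition appr_support : set (extended_group G) :=
  [set alpha | values alpha /\ appr alpha !=set0].

Definition appr_immediate : Prop :=
  \bigcap_(alpha in appr_support) appr alpha = set0.

(* "phi c for c ↗ x" *)
Definition eventually_near (phi : K -> Prop) : Prop :=
  exists alpha, [/\ value_group alpha, appr alpha !=set0 &
                    forall c, appr alpha c -> phi c].

Definition fixed_value (g : {poly K}) (alpha : extended_group G) : Prop :=
  values alpha /\ eventually_near (fun c => v (iota g.[c]) = alpha).

Definition fixes_value (g : {poly K}) : Prop :=
  exists alpha, fixed_value g alpha.

(* The degree of a polynomial g is (size g).-1; None stands for the degree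
   infinity of an approximation type. *)
Definition is_appr_degree (d : option nat) : Prop :=
  if d is Some n then
    (exists g, ~ fixes_value g /\ (size g).-1 = n) /\
    (forall g, ~ fixes_value g -> (n <= (size g).-1)%N)
  else forall g, fixes_value g.

(* f^`N(i) is the polynomial \sum_(j >= i) 'C(j, i) f_j X^(j - i). *)
Definition is_rel_appr_degree (f : {poly K}) (h : nat) : Prop :=
  let n := (size f).-1 in
  exists beta : nat -> extended_group G,
    [/\ forall i, (1 <= i <= n)%N -> fixed_value f^`N(i) (beta i),
        (1 <= h <= n)%N &
        eventually_near (fun c => forall i, (1 <= i <= n)%N -> i != h ->
          beta h + v (x - iota c) *+ h < beta i + v (x - iota c) *+ i)].

End ApproximationTypes.

(* Main.v *)
(* Write H for the henselization of K(f(x)). Since the approximation type is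
   immediate, there are c in K close to x and a in K with v(a) = v(x - c). Put
   y = (x - c)/a, a unit. By the definition of h, the Taylor expansion of f at c
   shows that y is a root of the polynomial (f(c + aY) - f(x)) / (f_h(c) a^h)
   over H, whose coefficient of index h is 1 and whose coefficients of higher
   index have positive value. The conjugates of y over the henselian field H have
   the same value, hence the minimal polynomial of y over H is integral, and
   comparing coefficients bounds its degree by h. Finally H(y) = H(x) is again
   henselian, so it is the henselization of K(x).

   That conjugates over a henselian field have equal values is derived from
   Hensel's Lemma alone: if k of the conjugates have the least value, the
   product of these k dominates the sum of all products of k conjugates, which is
   rational; so Hensel's Lemma, applied to the polynomial whose roots are these
   products, makes it rational. The same holds for the other symmetric functions
   of the k conjugates, so no proper subset can have the least value. *)
Require Import Defs.
From HB Require Import structures.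
From mathcomp Require Import all_boot all_order all_algebra.
From mathcomp Require Import boolp classical_sets.
From mathcomp Require Import perm mpoly.

Set Implicit Arguments.
Unset Strict Implicit.
Unset Printing Implicit Defensive.

Import Order.TTheory GRing.Theory Num.Theory.
Local Open Scope classical_set_scope.
Local Open Scope ring_scope.

(** * Valuation rings *)

Section Valuations.
Context {F : fieldType} {G : orderedGroup}.
Variable v : valuation F G.
Implicit Types a b c : F.

(** The valuation ring and its maximal ideal. Comparisons of values are turned into memberships of
    quotients in them, so that the closure lemmas of [rpred] apply. *)
Definition vring : {pred F} := [pred a | 0 <= v a :> extended_group G].
Definition vmax : {pred F} := [pred a | 0 < v a :> extended_group G].

Lemma eg_leD2r (x y z : extended_group G) : x <= y -> x + z <= y + z.
Proof.
by case: x y z => [a|] [b|] [c|] //; apply: (@orderedGroup_leD2r G).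
Qed.

Lemma val_neq_infty a : (v a != None :> extended_group G) = (a != 0).
Proof.
by apply: (congr1 negb); apply/eqP/eqP => [/valuation_eq_infty|->] //;
   apply/valuation_eq_infty.
Qed.

Lemma val_zero : v 0 = None.
Proof. exact/valuation_eq_infty. Qed.

Lemma val_addI c (x y : extended_group G) : c != 0 ->
  x + v c = y + v c -> x = y.
Proof.
rewrite -val_neq_infty; case: (v c) => // g _.
case: x y => [a|] [b|] // [] /addIr -> //.
Qed.

Lemma val_one : v 1 = 0.
Proof.
by apply: (@val_addI 1) (oner_neq0 _) _; rewrite add0r -valuationM mulr1.
Qed.

(** The value of [- 1] added to itself is 0, and a totally ordered group has no torsion. *)
Lemma val_opp a : v (- a) = v a.
Proof.
suff v_sign : v (- 1) = 0 by rewrite -mulN1r valuationM v_sign add0r.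
have := valuationM v (- 1) (- 1); rewrite mulrNN mulr1 val_one.
case: (v (- 1)) => // g [] gg; congr Some.
have /orP[g0|g0] := @orderedGroup_total G 0 g.
  by apply/le_anti; rewrite g0 andbT; have := orderedGroup_leD2r g g0;
     rewrite add0r -gg.
by apply/le_anti; rewrite g0 /=; have := orderedGroup_leD2r g g0;
   rewrite add0r -gg.
Qed.

Lemma vring_subring : subring_closed vring.
Proof.
split; rewrite ?inE ?val_one //.
- move=> a b; rewrite !inE => a0 b0.
  by apply: le_trans (valuationD v _ _); rewrite le_min a0 val_opp.
- move=> a b; rewrite !inE valuationM => a0 b0.
  by apply: le_trans b0 _; rewrite -[leLHS]add0r eg_leD2r.
Qed.
HB.instance Definition _ := GRing.isSubringClosed.Build F vring vring_subring.

Lemma vmax_zmod : zmod_closed vmax.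
Proof.
split; first by rewrite inE val_zero.
move=> a b; rewrite !inE => a0 b0.
by apply: lt_le_trans (valuationD v _ _); rewrite lt_min a0 val_opp.
Qed.
HB.instance Definition _ := GRing.isZmodClosed.Build F vmax vmax_zmod.

Lemma vmaxW a : a \in vmax -> a \in vring.
Proof. by rewrite !inE => /ltW. Qed.

Lemma vmaxMl a b : a \in vring -> b \in vmax -> a * b \in vmax.
Proof.
rewrite !inE valuationM => a0 b0.
by apply: lt_le_trans b0 _; rewrite -[leLHS]add0r eg_leD2r.
Qed.

Lemma vmaxMr a b : a \in vmax -> b \in vring -> a * b \in vmax.
Proof. by move=> a0 b0; rewrite mulrC vmaxMl. Qed.

Lemma vunitE a : (v a == 0) = (a \in vring) && (a \notin vmax).
Proof. by rewrite !inE -leNgt -eq_le eq_sym. Qed.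

Lemma vunit_vring a : v a = 0 -> a \in vring.
Proof. by move=> va; rewrite inE va. Qed.

Lemma vunit_vmax a : v a = 0 -> a \notin vmax.
Proof. by move=> va; rewrite inE va ltxx. Qed.

Lemma vunit_neq0 a : v a = 0 -> a != 0.
Proof. by rewrite -val_neq_infty => ->. Qed.

Lemma vunitM a b : v a = 0 -> v b = 0 -> v (a * b) = 0.
Proof. by rewrite valuationM => -> ->; rewrite addr0. Qed.

Lemma vunitX a n : v a = 0 -> v (a ^+ n) = 0.
Proof.
by move=> va; elim: n => [|n IH]; rewrite ?expr0 ?val_one ?exprS ?vunitM.
Qed.

Lemma vunitV a : v a = 0 -> v a^-1 = 0.
Proof.
move=> va; have a0 := vunit_neq0 va; apply: (val_addI a0).
by rewrite -valuationM mulVf // val_one va addr0.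
Qed.

Lemma vunitD a b : v a = 0 -> b \in vmax -> v (a + b) = 0.
Proof.
move=> va b0; apply/eqP; rewrite vunitE rpredD ?(vmaxW b0) ?vunit_vring //=.
by apply: contra (vunit_vmax va) => /rpredB/(_ b0); rewrite addrK.
Qed.

Lemma vunitMl a b : v a = 0 -> v (a * b) = v b.
Proof. by rewrite valuationM => ->; rewrite add0r. Qed.

Lemma vmax_unit a b : v a = 0 -> a * b \in vmax -> b \in vmax.
Proof. by move=> va; rewrite !inE vunitMl. Qed.

Lemma vunit_prod (I : Type) (r : seq I) (P : pred I) (E : I -> F) :
  (forall i, P i -> v (E i) = 0) -> v (\prod_(i <- r | P i) E i) = 0.
Proof.
by move=> E0; elim/big_rec: _ => [|i a Pi a0]; rewrite ?val_one ?vunitM ?E0.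
Qed.

Lemma vmax_prod (I : finType) (P : pred I) (E : I -> F) (j : I) :
  P j -> E j \in vmax -> (forall i, P i -> E i \in vring) ->
  \prod_(i | P i) E i \in vmax.
Proof.
move=> Pj Ej E0; rewrite (bigD1 j) //= vmaxMr // rpred_prod // => i /andP[+ _].
exact: E0.
Qed.

Lemma le_val_div a b : a != 0 -> (v a <= v b) = (b / a \in vring).
Proof.
move=> a0; rewrite inE; apply/idP/idP => [/(@eg_leD2r _ _ (v a^-1))|].
  by rewrite -!valuationM divff // val_one.
by move/(@eg_leD2r _ _ (v a)); rewrite -valuationM divfK // add0r.
Qed.

Lemma lt_val_div a b : a != 0 -> (v a < v b) = (b / a \in vmax).
Proof.
move=> a0; have [->|b0] := eqVneq b 0.
  by rewrite mul0r rpred0 val_zero lt_neqAle val_neq_infty a0.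
rewrite ltNge le_val_div // [RHS]inE ltNge; congr (~~ _).
rewrite !inE; apply/idP/idP => [/(@eg_leD2r _ _ (v (b / a)))|].
  by rewrite -valuationM mulrA divfK // divff // val_one add0r.
move/(@eg_leD2r _ _ (v (a / b))).
by rewrite -valuationM mulrA divfK // divff // val_one add0r.
Qed.

Lemma eq_val_div a b : a != 0 -> (v a = v b) <-> v (b / a) = 0.
Proof.
move=> a0; split=> [vab|].
  apply: (val_addI a0); rewrite -valuationM divfK // add0r //.
by rewrite -[in v b](divfK a0 b) [v (_ * a)]valuationM => ->; rewrite add0r.
Qed.

Lemma vringVn a : a \notin vring -> a^-1 \in vmax.
Proof.
move=> a_nring; have a0 : a != 0.
  by apply: contra a_nring => /eqP->; rewrite rpred0.
have : v a < v 1 by rewrite val_one ltNge; apply: contra a_nring; rewrite inE.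
by rewrite lt_val_div // div1r.
Qed.

End Valuations.

(** * Subfields and symmetric functions *)

Section SubfieldType.
Context {F : fieldType} {E : set F}.
Hypothesis sE : subfield E.

(** The proof is an argument of the predicate so that the closure structure can be attached to it
    and inferred. *)
Definition subfield_pred of subfield E : {pred F} := mem E.

Fact subfield_predP : divring_closed (subfield_pred sE).
Proof. exact: sE. Qed.
HB.instance Definition _ :=
  GRing.isDivringClosed.Build F (subfield_pred sE) subfield_predP.

Record subfield_type := SubfieldType {
  subfield_val : F; _ : subfield_val \in subfield_pred sE }.
HB.instance Definition _ := [isSub for subfield_val].
HB.instance Definition _ := [Choice of subfield_type by <:].
HB.instance Definition _ := [SubChoice_isSubComUnitRing of subfield_type by <:].
HB.instance Definition _ :=
  [SubComUnitRing_isSubIntegralDomain of subfield_type by <:].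
HB.instance Definition _ := [SubIntegralDomain_isSubField of subfield_type
  by <:].

(** Replaces a set by a field type with an embedding, so that division, gcd and multivariate
    polynomials over the subfield become available. *)
Lemma subfield_range : exists (T : fieldType) (j : {rmorphism T -> F}),
  E = range j.
Proof.
exists subfield_type, (val : {rmorphism subfield_type -> F}).
apply/seteqP; split=> y /=.
  move=> /mem_set Ey; exists (SubfieldType Ey) => //.
by case=> [[z Ez] _ <-]; apply: set_mem.
Qed.

End SubfieldType.

Lemma range_subfield (T F : fieldType) (j : {rmorphism T -> F}) :
  subfield (range j).
Proof.
split; first by apply/mem_set; exists 1; rewrite ?rmorph1.
- move=> _ _ /set_mem[a _ <-] /set_mem[b _ <-]; apply/mem_set.
  by exists (a - b); rewrite ?rmorphB.
- move=> _ _ /set_mem[a _ <-] /set_mem[b _ <-]; apply/mem_set.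
  by exists (a / b); rewrite ?fmorph_div.
Qed.

Lemma map_poly_lift (T F : fieldType) (j : {rmorphism T -> F}) (p : {poly F}) :
  (forall i, range j p`_i) -> exists q : {poly T}, p = map_poly j q.
Proof.
move=> pj; have {}pj i : exists c, j c = p`_i by case: (pj i) => c; exists c.
have [c cP] := boolp.choice pj; exists (\poly_(i < size p) c i).
apply/polyP=> i; rewrite coef_map coef_poly; case: ltnP => [_|le_pi] /=.
  by rewrite cP.
by rewrite rmorph0 nth_default.
Qed.

Lemma map_poly_range (T F : fieldType) (j : {rmorphism T -> F})
    (q : {poly T}) i :
  range j (map_poly j q)`_i.
Proof. by rewrite coef_map; exists q`_i. Qed.

Definition rangep (T F : fieldType) (j : {rmorphism T -> F}) : {pred F} :=
  subfield_pred (range_subfield j).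
HB.instance Definition _ T F j := GRing.DivringClosed.on (@rangep T F j).

Lemma rangepP (T F : fieldType) (j : {rmorphism T -> F}) y :
  reflect (range j y) (y \in rangep j).
Proof. by apply: (iffP idP) => [/set_mem|/mem_set]. Qed.

Lemma rangep_val (T F : fieldType) (j : {rmorphism T -> F}) t :
  j t \in rangep j.
Proof. by apply/rangepP; exists t. Qed.

(** * Symmetric polynomials evaluated at the roots of a polynomial *)

Section Symmetric.
Context {T F : fieldType} {j : {rmorphism T -> F}}.
Variables (n : nat) (r : n.-tuple F).
Local Notation ev := (mmap j (tnth r)).

Lemma ev_mesym k : ev (mesym n T k) = (mesym n F k).@[tnth r].
Proof.
rewrite !raddf_sum; apply: eq_bigr => h _; rewrite /= !rmorph_prod /=.
by apply: eq_bigr => i _; rewrite /= mmapX mmap1U mevalXU.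
Qed.

(** By the fundamental theorem it suffices to evaluate elementary symmetric polynomials, and these
    give the coefficients of [p] up to sign. *)
Lemma ev_symmetric (p : {poly T}) (t : {mpoly T[n]}) :
  map_poly j p = \prod_(c <- r) ('X - c%:P) -> t \is symmetric ->
  ev t \in rangep j.
Proof.
move=> p_r /sym_fundamental[t' [<- _]]; rewrite comp_mpolyEX raddf_sum.
apply: rpred_sum => m _; rewrite /= mmapZ comp_mpolyX rmorph_prod.
rewrite rpredM ?rangep_val // rpred_prod // => i _;
  rewrite rmorphXn /= rpredX //.
rewrite tnth_mktuple ev_mesym.
have lt_in : (i.+1 < n.+1)%N by rewrite ltnS ltn_ord.
have := mroots_coeff r (Ordinal lt_in); rewrite -p_r coef_map /=.
move/(congr1 ( *%R ((-1) ^+ i.+1))); rewrite signrMK => <-.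
by rewrite rpredM ?rpredX ?rpredN ?rpred1 ?rangep_val.
Qed.

Lemma ev_sym_poly (p : {poly T}) (Q : {poly {mpoly T[n]}}) :
  map_poly j p = \prod_(c <- r) ('X - c%:P) ->
  (forall s, map_poly (msym s) Q = Q) ->
  forall i, (map_poly ev Q)`_i \in rangep j.
Proof.
move=> p_r symQ i; rewrite coef_map /=; apply: ev_symmetric p_r _.
by apply/issymP => s; rewrite -[in RHS](symQ s) coef_map.
Qed.

End Symmetric.

(** * Conjugates over henselian fields *)

(*BEGIN*)
Section Hensel.
Context {F : fieldType} {G : orderedGroup} {v : valuation F G}.
Context {T : fieldType} {j : {rmorphism T -> F}}.
Hypothesis hensel : henselian v (range j).

(** The sum [a] of all roots is, up to sign, a coefficient, hence rational, and it is congruent to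
    [c s0]. Hensel's Lemma at [a] yields a rational root in this residue class, and [c s0] is the
    only root there. *)
Lemma hensel_dominating_root (I : finType) (P : pred I) (c : I -> F) (s0 : I) :
    P s0 -> v (c s0) = 0 ->
    (forall s, P s -> s != s0 -> c s \in vmax v) ->
    (forall i, (\prod_(s | P s) ('X - (c s)%:P))`_i \in rangep j) ->
  c s0 \in rangep j.
Proof.
move=> Ps0 c0 c_max; set Q := \prod_(s | _) _ => Qj.
pose a := \sum_(s | P s) c s.
have aj : a \in rangep j.
  have cs : Q = \prod_(y <- map c (filter P (index_enum I))) ('X - y%:P).
    by rewrite big_map big_filter.
  have : size (map c (filter P (index_enum I))) != 0%N.
    rewrite size_map size_filter -lt0n -has_count; apply/hasP.
    by exists s0; rewrite ?mem_index_enum.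
  move/coefPn_prod_XsubC; rewrite -cs big_map big_filter -/a.
  by move/(canLR (@opprK _)) => <-; rewrite rpredN size_map.
have c_ring s : P s -> c s \in vring v.
  have [->|s_s0] := eqVneq s s0 => Ps; first exact: vunit_vring.
  by rewrite vmaxW ?c_max.
have a_c0 : a - c s0 \in vmax v.
  rewrite /a (bigD1 s0) //= addrAC subrr add0r rpred_sum // => s /andP[].
  exact: c_max.
have a0 : v a = 0 by rewrite -(subrK (c s0) a) addrC vunitD.
have Q_ring : Q \is a polyOver (vring v).
  by rewrite rpred_prod // => s Ps; rewrite polyOverXsubC c_ring.
have Qa : Q.[a] \in vmax v.
  rewrite horner_prod (vmax_prod Ps0) //= ?hornerXsubC // => s Ps.
  by rewrite hornerXsubC rpredB ?c_ring ?vunit_vring.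
have Q'a : v Q^`().[a] = 0.
  rewrite /Q (bigD1 s0) //= derivM derivXsubC mul1r hornerD vunitD //.
    rewrite horner_prod vunit_prod // => s /andP[Ps s_s0].
    by rewrite hornerXsubC vunitD // rpredN c_max.
  rewrite hornerM hornerXsubC vmaxMr // rpred_horner ?vunit_vring //.
  rewrite polyOver_deriv // rpred_prod // => s /andP[Ps _].
  by rewrite polyOverXsubC c_ring.
have [|||b [bj + b_a]] := hensel (p := Q) (a := a) _ _ _ Qa Q'a.
- by move=> i; split; [apply/rangepP | apply: (polyOverP Q_ring)].
- exact/rangepP.
- by rewrite a0.
rewrite /root horner_prod prodf_seq_eq0 => /hasP[s _ /andP[Ps]].
rewrite hornerXsubC subr_eq0 => /eqP b_cs.
have [s_s0|s_s0] := eqVneq s s0; first by rewrite -s_s0 -b_cs; apply/rangepP.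
case/negP: (vunit_vmax a0); rewrite -[a](subKr b) rpredB //.
by rewrite b_cs c_max.
Qed.

Section ConjugateRoots.
Variables (n : nat) (r : n.-tuple F) (p q : {poly T}).
Hypothesis p_r : map_poly j p = \prod_(c <- r) ('X - c%:P).
Hypothesis q_ring : forall i, (map_poly j q).[tnth r i] \in vring v.
Local Notation ev := (mmap j (tnth r)).
Local Notation rho i := (map_poly j q).[tnth r i].

Let S0 := [set i | rho i \notin vmax v]%SET.

(** Permutations of the variables permute the [C S] with [S] of the size of [S0]. Hence the
    polynomial whose roots are their evaluations is rational, and [hensel_dominating_root] applies
    to it. *)
Lemma ev_equivariant (C : {set 'I_n} -> {mpoly T[n]}) :
    (forall (s : 'S_n) S, msym s (C S) = C (s @: S)%SET) ->
    v (ev (C S0)) = 0 ->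
    (forall S : {set 'I_n}, #|S| = #|S0| -> S != S0 -> ev (C S) \in vmax v) ->
  ev (C S0) \in rangep j.
Proof.
move=> C_eqv C0 C_max.
apply: (@hensel_dominating_root _ (fun S : {set 'I_n} => #|S| == #|S0|)
  (fun S => ev (C S)) S0) => // [S /eqP|i]; first exact: C_max.
pose Q := \prod_(S : {set 'I_n} | #|S| == #|S0|) ('X - (C S)%:P).
have symQ s : map_poly (msym s) Q = Q.
  rewrite rmorph_prod [RHS](reindex_inj (imset_inj (@perm_inj _ s))) /=.
  apply: eq_big => S; first by rewrite card_imset //; apply: perm_inj.
  by move=> _; rewrite map_polyXsubC; congr ('X - _%:P); apply: C_eqv.
have := ev_sym_poly p_r symQ i; rewrite rmorph_prod.
by under eq_bigr do rewrite /= map_polyXsubC.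
Qed.

Let X_ i : {mpoly T[n]} := (map_poly (@mpolyC n T) q).['X_i].

Lemma ev_X i : ev (X_ i) = rho i.
Proof.
rewrite /X_ -horner_map -map_poly_comp /= mmapX mmap1U.
by congr (_.[_]); apply: eq_map_poly => c /=; rewrite mmapC.
Qed.

Lemma msym_X (s : 'S_n) i : msym s (X_ i) = X_ (s i).
Proof.
rewrite /X_ -horner_map -map_poly_comp /= msymX.
congr (_.[_]); last first.
  by congr 'X_[_]; apply/mnmP => k; rewrite mnmE !mnm1E (canF_eq (permK s)).
by apply: eq_map_poly => c /=; rewrite /msym mmapC.
Qed.

(** Formal counterparts of the product of the [rho i], and of the monic polynomial with these roots,
    on which the symmetric group acts. *)
Let b (S : {set 'I_n}) : {mpoly T[n]} := \prod_(i in S) X_ i.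
Let D (S : {set 'I_n}) : {poly {mpoly T[n]}} := \prod_(i in S) ('X - (X_ i)%:P).

Lemma msym_b (s : 'S_n) (S : {set 'I_n}) : msym s (b S) = b (s @: S)%SET.
Proof.
rewrite /b rmorph_prod big_imset /=; last by move=> ? ? _ _; apply: perm_inj.
by apply: eq_bigr => i _; apply: msym_X.
Qed.

Lemma msym_D (s : 'S_n) (S : {set 'I_n}) k :
  msym s (D S)`_k = (D (s @: S)%SET)`_k.
Proof.
rewrite -(coef_map (msym s)); congr ((polyseq _)`_k).
rewrite /D rmorph_prod big_imset /=; last by move=> ? ? _ _; apply: perm_inj.
by apply: eq_bigr => i _; rewrite map_polyXsubC; congr ('X - _%:P);
  apply: msym_X.
Qed.

Lemma ev_b S : ev (b S) = \prod_(i in S) rho i.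
Proof.
by rewrite /b rmorph_prod; apply: eq_bigr => i _; apply: ev_X.
Qed.

Lemma ev_D S k : ev (D S)`_k = (\prod_(i in S) ('X - (rho i)%:P))`_k.
Proof.
rewrite -(coef_map ev); congr ((polyseq _)`_k); rewrite /D rmorph_prod.
by apply: eq_bigr => i _; rewrite /= map_polyXsubC; congr ('X - _%:P);
  apply: ev_X.
Qed.

Lemma ev_b0 : v (ev (b S0)) = 0.
Proof.
rewrite ev_b vunit_prod // => i; rewrite inE => i0.
by apply/eqP; rewrite vunitE q_ring.
Qed.

(** Another set of the same size contains an index outside [S0], which contributes a factor in
    [vmax]. *)
Lemma ev_b_max (S : {set 'I_n}) :
  #|S| = #|S0| -> S != S0 -> ev (b S) \in vmax v.
Proof.
move=> cS S_S0; have [i iS i0] : exists2 i, i \in S & i \notin S0.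
  apply/subsetPn; apply: contra S_S0 => subS.
  by rewrite eqEcard subS cS /=.
rewrite ev_b (vmax_prod iS) //.
by move: i0; rewrite inE negbK.
Qed.

Lemma ev_D_vring S k : ev (D S)`_k \in vring v.
Proof.
rewrite ev_D; move: k; apply/polyOverP; rewrite rpred_prod // => i _.
by rewrite polyOverXsubC.
Qed.

(* The product of the unit values is congruent to the sum of all products of
   [#|S0|] values, hence rational; the same argument with this product times
   [t] or [1 + t], t a coefficient, shows that the coefficients are rational. *)
Lemma ev_D0 k : (\prod_(i in S0) ('X - (rho i)%:P))`_k \in rangep j.
Proof.
rewrite -ev_D; set t := ev _.
have bj : ev (b S0) \in rangep j.
  exact: (ev_equivariant msym_b ev_b0 ev_b_max).
have b_neq0 := vunit_neq0 ev_b0.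
(* The cofactor of the product must be a unit: [1 + t] is one when [t] is not. *)
have [t_max|t_unit] := boolP (t \in vmax v).
  suff : ev (b S0 * (1 + (D S0)`_k)) \in rangep j.
    by rewrite rmorphM rmorphD rmorph1 -/t fpredMl // => /rpredB/(_ (rpred1
      _)); rewrite addrC addKr.
  apply: (ev_equivariant (C := fun S => b S * (1 + (D S)`_k))).
  - by move=> s S; rewrite msymM msymD msym1 msym_b msym_D.
  - by rewrite rmorphM rmorphD rmorph1 vunitM ?ev_b0 // vunitD ?val_one.
  - move=> S cS S_S0; rewrite rmorphM vmaxMr ?ev_b_max //.
    by rewrite rmorphD rmorph1 rpredD ?rpred1 ?ev_D_vring.
suff : ev (b S0 * (D S0)`_k) \in rangep j by rewrite rmorphM fpredMl.
apply: (ev_equivariant (C := fun S => b S * (D S)`_k)).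
- by move=> s S; rewrite msymM msym_b msym_D.
- by rewrite rmorphM vunitM ?ev_b0 //; apply/eqP;
    rewrite vunitE t_unit ev_D_vring.
- by move=> S cS S_S0; rewrite rmorphM vmaxMr ?ev_b_max ?ev_D_vring.
Qed.

(** The monic polynomial [g0] with roots [rho l], for [l] in [S0], is rational. If [rho k] were a
    unit, [g0 \Po q] would vanish at the root of index [k], hence at that of index [i], and [rho i]
    would equal some unit [rho l]. *)
Lemma conj_vmax (i k : 'I_n) :
    (forall g : {poly T}, root (map_poly j g) (tnth r k) ->
                          root (map_poly j g) (tnth r i)) ->
  rho i \in vmax v -> rho k \in vmax v.
Proof.
move=> conj_ik i_max; apply/negPn/negP => k_unit.
have [g0 g0E] : exists g0, \prod_(l in S0) ('X - (rho l)%:P) = map_poly j g0.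
  by apply: map_poly_lift => l; apply/rangepP/ev_D0.
have root_g0 a : root (map_poly j (g0 \Po q)) a =
    [exists l in S0, (map_poly j q).[a] == rho l].
  rewrite map_comp_poly -g0E /root horner_comp horner_prod prodf_seq_eq0.
  apply/hasP/exists_inP => [[l _ /andP[lS]]|[l lS /eqP->]].
    by rewrite hornerXsubC subr_eq0; exists l.
  by exists l; rewrite ?mem_index_enum // lS hornerXsubC subrr eqxx.
have /conj_ik : root (map_poly j (g0 \Po q)) (tnth r k).
  by rewrite root_g0; apply/exists_inP; exists k; rewrite ?inE.
rewrite root_g0 => /exists_inP[l]; rewrite inE => l_unit /eqP rho_il.
by rewrite -rho_il i_max in l_unit.
Qed.

End ConjugateRoots.
End Hensel.

(** * Minimal polynomials *)

(*BEGIN*)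
Section MinimalPolynomial.
Context {T F : fieldType} {j : {rmorphism T -> F}}.

(** Encoded as the monic generator of the ideal of polynomials vanishing at [y]; irreducibility is
    not stated as such. *)
Definition is_minpoly (y : F) (m : {poly T}) : Prop :=
  m \is monic /\ forall g, root (map_poly j g) y = (m %| g).

Lemma minpoly_root y m : is_minpoly y m -> root (map_poly j m) y.
Proof. by case=> _ ->. Qed.

Lemma minpoly_exists y : algebraicOver j y -> exists m, is_minpoly y m.
Proof.
pose P n := `[<exists p : {poly T}, [/\ size p = n, p != 0 & root (map_poly j
  p) y]>].
case=> p0 p0_neq0 p0_y; have exP : exists n, P n.
  by exists (size p0); apply/asboolP; exists p0.
case: (ex_minnP exP) => n /asboolP[m [m_n m0 m_y]] n_min.
exists ((lead_coef m)^-1 *: m); split.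
  by rewrite monicE lead_coefZ mulVf ?lead_coef_eq0.
move=> g; rewrite dvdpZl ?invr_eq0 ?lead_coef_eq0 //.
apply/idP/idP => [g_y|/dvdpP[s ->]]; last by rewrite rmorphM rootM m_y orbT.
apply/negPn/negP; rewrite /dvdp => gm0.
have := ltn_modp g m; rewrite m0 m_n ltnNge => /negP[]; apply: n_min.
apply/asboolP; exists (g %% m); split=> //.
move: g_y; rewrite {1}(divp_eq g m) rmorphD rmorphM /root hornerD hornerM.
by rewrite (rootP m_y) mulr0 add0r.
Qed.

(** The minimal polynomial [m'] of [y'] divides [m], say with quotient [s]. If [y] were a root of
    [s], then [m] would divide [s], which has smaller degree; so [y] is a root of [m'] and [m]
    divides [m']. *)
Lemma minpoly_conj y m y' :
  is_minpoly y m -> root (map_poly j m) y' -> is_minpoly y' m.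
Proof.
move=> [m_monic m_y] my'.
have [|m' [m'_monic m'_y']] := @minpoly_exists y'.
  by exists m; rewrite ?monic_neq0.
split=> // g; rewrite m'_y'; apply/idP/idP; last first.
  by move=> /dvdpP[s ->]; rewrite dvdp_mull // -m'_y'.
suff m_m' : m %| m' by apply: dvdp_trans.
have := my'; rewrite m'_y' => /dvdpP[s mE].
have : root (map_poly j m) y by rewrite m_y.
rewrite {1}mE rmorphM rootM !m_y => /orP[m_s|//].
have s0 : s != 0 by apply: contraTneq (monic_neq0 m_monic) => s0;
  rewrite mE s0 mul0r eqxx.
have := dvdp_leq s0 m_s; rewrite mE size_Mmonic //.
have : (1 < size m')%N.
  have : root (map_poly j m') y' by rewrite m'_y'.
  by move/root_size_gt1; rewrite size_map_poly map_poly_eq0 monic_neq0 // => ->.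
move: s0; rewrite -size_poly_gt0; case: (size s) (size m') => [|a] [|[|b]] //.
by move=> _ _; rewrite addnS /= -[X in (_ <= X)%N]addn0 leq_add2l.
Qed.

End MinimalPolynomial.

(** * Equality of the values of conjugates *)

Section UniqueExtension.
Context {F : closedFieldType} {G : orderedGroup} {v : valuation F G}.
Context {T : fieldType} {j : {rmorphism T -> F}}.
Hypothesis hensel : henselian v (range j).

(* If the values of the conjugates differ and k of them have the least value,
   then, e being the k-th elementary symmetric function, X^k / e maps exactly
   these k conjugates to units and the other ones to vmax. *)
Lemma val_conj (y y' : F) (m : {poly T}) :
  is_minpoly (j := j) y m -> root (map_poly j m) y' -> v y = v y'.
Proof.
move=> m_y my'; have [m_monic _] := m_y.
have [r' m_r'] := closed_field_poly_normal (map_poly j m).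
rewrite lead_coef_map (monicP m_monic) rmorph1 scale1r in m_r'.
pose n := size r'; pose r : n.-tuple F := in_tuple r'.
have m_r : map_poly j m = \prod_(c <- r) ('X - c%:P) by [].
have min_r i : is_minpoly (j := j) (tnth r i) m.
  by apply: minpoly_conj m_y _; rewrite m_r root_prod_XsubC mem_tnth.
have /tnthP[i ->] : y \in r by rewrite -root_prod_XsubC -m_r;
  apply: minpoly_root.
have /tnthP[i' ->] : y' \in r by rewrite -root_prod_XsubC -m_r.
have [i0 _ i0_min] := @arg_minP _ _ _ i xpredT (fun i => v (tnth r i)) isT.
suff eq_i0 k : v (tnth r k) = v (tnth r i0) by rewrite !eq_i0.
set r0 := tnth r i0 in i0_min *.
(* If [r0] is zero, the least value is infinity and all conjugates share it. *)
have [r0_eq0|r0_neq0] := eqVneq r0 0.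
  move: (i0_min k isT); rewrite r0_eq0 val_zero.
  by case: (v (tnth r k)).
apply/esym/eq_val_div => //.
pose z l := tnth r l / r0.
have z_ring l : z l \in vring v by rewrite -le_val_div // i0_min.
apply/eqP; rewrite vunitE z_ring /=; apply/negP => zk_max.
pose S0 := [set l | z l \notin vmax v]%SET.
pose e := \sum_(S : {set 'I_n} | #|S| == #|S0|) \prod_(l in S) tnth r l.
have ej : e \in rangep j.
  suff <- : mmap j (tnth r) (mesym n T #|S0|) = e.
    exact: ev_symmetric m_r (mesym_sym _ _ _).
  rewrite raddf_sum; apply: eq_bigr => h _; rewrite /= rmorph_prod.
  by apply: eq_bigr => l _; rewrite /= mmapX mmap1U.
have eE : e / r0 ^+ #|S0| =
    \sum_(S : {set 'I_n} | #|S| == #|S0|) \prod_(l in S) z l.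
  rewrite /e mulr_suml; apply: eq_bigr => S /eqP cS.
  by rewrite big_split /= prodr_const cS exprVn.
have e_unit : v (e / r0 ^+ #|S0|) = 0.
  rewrite eE (bigD1 S0) //= vunitD //.
    by rewrite vunit_prod // => l; rewrite inE => l0; apply/eqP;
      rewrite vunitE z_ring.
  rewrite rpred_sum // => S /andP[/eqP cS S_S0].
  have [l lS l0] : exists2 l, l \in S & l \notin S0.
    by apply/subsetPn; apply: contra S_S0 => subS; rewrite eqEcard subS cS /=.
  by apply: (vmax_prod lS) => //; move: l0; rewrite inE negbK.
have S0_gt0 : (0 < #|S0|)%N.
  apply/card_gt0P; exists i0; rewrite inE /z divff //.
  exact/vunit_vmax/val_one.
have [e' _ e'E] := rangepP _ _ ej.
(* Division by [r0] need not be rational. Division of the power by [e] is, and it differs from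
   [z l ^+ #|S0|] by a unit factor only. *)
pose q := e'^-1 *: 'X^#|S0|.
have qE l : (map_poly j q).[tnth r l] = (e / r0 ^+ #|S0|)^-1 * z l ^+ #|S0|.
  rewrite map_polyZ map_polyXn hornerZ hornerXn fmorphV e'E invf_div.
  by rewrite expr_div_n [RHS]mulrC mulrA divfK ?expf_neq0 // mulrC.
have q_ring l : (map_poly j q).[tnth r l] \in vring v.
  by rewrite qE rpredM ?rpredX // vunit_vring ?vunitV.
have qk : (map_poly j q).[tnth r k] \in vmax v.
  rewrite qE vmaxMl ?vunit_vring ?vunitV // -(prednK S0_gt0) exprS.
  by rewrite vmaxMr ?rpredX.
have /negP[] : (map_poly j q).[tnth r i0] \notin vmax v.
  by rewrite vunit_vmax // qE vunitM ?vunitX ?vunitV // /z divff // val_one.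
apply: (conj_vmax hensel m_r q_ring _ qk) => g.
by rewrite (min_r i0).2 (min_r k).2.
Qed.

End UniqueExtension.

(** * Roots of polynomials and residue classes *)

(*BEGIN*)
Section HenselRoots.
Context {F : fieldType} {G : orderedGroup} {v : valuation F G}.
Implicit Types (p : {poly F}) (a b : F).

Lemma horner_sub_vmax p a b :
  p \is a polyOver (vring v) -> a \in vring v -> b \in vring v ->
  b - a \in vmax v -> p.[b] - p.[a] \in vmax v.
Proof.
move=> p_ring a_ring b_ring b_a; rewrite !horner_coef -sumrB.
apply: rpred_sum => i _; rewrite -mulrBr subrXX mulrCA vmaxMr //.
rewrite rpredM ?(polyOverP p_ring) // rpred_sum // => k _.
by rewrite rpredM // rpredX.
Qed.

Lemma vunit_deriv_near p a b :
    p \is a polyOver (vring v) -> a \in vring v -> b - a \in vmax v ->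
  v p^`().[a] = 0 -> v p^`().[b] = 0.
Proof.
move=> p_ring a_ring b_a p'a.
rewrite -(subrK p^`().[a] p^`().[b]) addrC vunitD // horner_sub_vmax //.
  by rewrite polyOver_deriv.
by rewrite -(subrK a b) rpredD ?(vmaxW b_a).
Qed.

Lemma hensel_root_unique p a b b' :
    p \is a polyOver (vring v) -> a \in vring v -> v p^`().[a] = 0 ->
    root p b -> b - a \in vmax v -> root p b' -> b' - a \in vmax v -> b = b'.
Proof.
move=> p_ring a_ring p'a /rootP pb b_a /rootP pb' b'_a.
have b_ring : b \in vring v by rewrite -(subrK a b) rpredD ?(vmaxW b_a).
have p'b := vunit_deriv_near p_ring a_ring b_a p'a.
pose h := b' - b; have h_max : h \in vmax v.
  by rewrite /h -(subrK a b') -addrA rpredD // -opprB rpredN.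
pose w := \sum_(i < size p) p^`N(i.+2).[b] * h ^+ i.
have w_ring : w \in vring v.
  rewrite rpred_sum // => i _.
  by rewrite rpredM ?rpredX ?rpred_horner ?polyOver_nderivn // vmaxW.
have : p.[b + h] = p.[b] + h * (p^`().[b] + h * w).
  (* Two surplus terms allow the orders 0 and 1 to be split off whatever the size of [p]. *)
  rewrite (@nderiv_taylor_wide _ (size p).+2) ?leqW //; last exact: mulrC.
  rewrite !big_ord_recl /= nderivn0 poly.nderivn1 expr0 mulr1 expr1.
  rewrite [h * (p^`().[b] + _)]mulrDr mulrA mulr_sumr.
  congr (_ + (_ + _)); first exact: mulrC.
  by apply: eq_bigr => i _; rewrite [RHS]mulrCA -expr2 -exprD.
rewrite /h addrC subrK pb pb' add0r => /esym/eqP; rewrite mulf_eq0 -/h.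
case/orP => [|/eqP p'h]; first by rewrite subr_eq0 => /eqP.
have /negP[] := vunit_vmax p'b.
by rewrite -(addrK (h * w) p^`().[b]) p'h sub0r rpredN vmaxMr.
Qed.

(* At a point with no root in its residue class, the logarithmic derivative of
   the polynomial is integral. *)
Lemma deriv_prod_XsubC_vring (r : seq F) a :
    {in r, forall z, a - z \notin vmax v} ->
  exists2 w, w \in vring v &
    (\prod_(z <- r) ('X - z%:P))^`().[a] = (\prod_(z <- r) ('X - z%:P)).[a] * w.
Proof.
elim: r => [|z r IH] a_r.
  by exists 0; rewrite ?rpred0 // big_nil derivC horner0 mulr0.
have [y yr|w w_ring wE] := IH; first by apply: a_r; rewrite inE yr orbT.
have a_z := a_r z (mem_head _ _).
have az0 : a - z != 0 by apply: contra a_z => /eqP->; rewrite rpred0.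
exists ((a - z)^-1 + w).
  rewrite rpredD //; have [az_ring|az_nring] := boolP (a - z \in vring v).
    by apply/vunit_vring/vunitV/eqP; rewrite vunitE az_ring.
  exact/vmaxW/vringVn.
rewrite big_cons derivM derivXsubC mul1r hornerD !hornerM hornerXsubC wE.
by rewrite mulrDr mulrAC divff // mul1r mulrA.
Qed.

End HenselRoots.

(** [p] splits. If no root were congruent to [a], the derivative at [a] would be an integral
    multiple of [p.[a]], hence not a unit. *)
Lemma hensel_root_exists (F : closedFieldType) (G : orderedGroup)
    (v : valuation F G) (p : {poly F}) (a : F) :
    p.[a] \in vmax v -> v p^`().[a] = 0 ->
  exists2 b, root p b & b - a \in vmax v.
Proof.
move=> pa p'a; have [r pE] := closed_field_poly_normal p.
have [/hasP[b br ab]|/hasPn a_r] := boolP (has (fun z => a - z \in vmax v) r).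
  exists b; last by rewrite -opprB rpredN.
  by rewrite pE; apply/rootP; rewrite hornerZ (rootP _) ?mulr0 //
    root_prod_XsubC.
have [w w_ring wE] := deriv_prod_XsubC_vring a_r.
have /negP[] := vunit_vmax p'a.
by rewrite pE derivZ hornerZ wE mulrA -hornerZ -pE vmaxMr.
Qed.

(** * Degrees of integral monic factors *)

Section DegreeBound.
Context {F : fieldType} {G : orderedGroup} {v : valuation F G}.

(* If s_k is the last coefficient of s of least value, then the leading
   coefficient of m makes the coefficient of index k + deg m dominate. *)
Lemma vunit_coef_degree (s m : {poly F}) (h : nat) :
    m \is monic -> m \is a polyOver (vring v) -> v (s * m)`_h = 0 ->
    (forall i, (h < i)%N -> (s * m)`_i \in vmax v) ->
  ((size m).-1 <= h)%N.
Proof.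
move=> m_monic m_ring smh sm_max.
have s0 : (0 < size s)%N.
  rewrite size_poly_gt0; apply/negP => /eqP s0.
  by move: smh; rewrite s0 mul0r coef0 val_zero.
have [i0 _ i0_min] := @arg_minP _ _ _ (Ordinal s0) xpredT (fun i => v s`_i) isT.
pose P k := v s`_k == v s`_i0.
have exP : exists k, P k by exists i0; rewrite /P.
have si0 : s`_i0 != 0.
  have : v s`_i0 <= v (lead_coef s).
    have ls : ((size s).-1 < size s)%N by rewrite prednK.
    exact: (i0_min (Ordinal ls)).
  apply: contraTneq => ->; rewrite val_zero -ltNge lt_neqAle val_neq_infty.
  by rewrite lead_coef_eq0 -size_poly_gt0 s0.
have P_lt k : P k -> (k <= size s)%N.
  rewrite leqNgt => /eqP Pk; apply/negP => /ltnW lt_k; case/eqP: si0.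
  by apply/(valuation_eq_infty v); rewrite -Pk nth_default // val_zero.
have [k /eqP Pk k_max] := ex_maxnP exP P_lt.
have sk0 : s`_k != 0 by rewrite -(val_neq_infty v) Pk val_neq_infty.
have s_ring i : s`_i / s`_k \in vring v.
  have [lt_is|le_si] := ltnP i (size s); last by
    rewrite nth_default ?mul0r ?rpred0.
  by rewrite -le_val_div // Pk; apply: (i0_min (Ordinal lt_is)).
have s_max i : (k < i)%N -> s`_i / s`_k \in vmax v.
  move=> lt_ki; rewrite -lt_val_div // lt_neqAle le_val_div // s_ring andbT.
  by apply: contraL lt_ki => ski; rewrite -leqNgt k_max // /P -Pk eq_sym.
have smE i : (s * m)`_i = s`_k * \sum_(l < i.+1) s`_l / s`_k * m`_(i - l).
  rewrite coefM mulr_sumr; apply: eq_bigr => l _.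
  by rewrite mulrA mulrCA divff // mulr1.
rewrite leqNgt; apply/negP => lt_hm; pose d := (size m).-1.
(* In this sum the terms with [l > k] lie in [vmax] by the choice of [k], those with [l < k] vanish
   because [m] has degree [d], and [l = k] gives 1. *)
have km : v (\sum_(l < (k + d).+1) s`_l / s`_k * m`_(k + d - l)) = 0.
  have lt_k : (k < (k + d).+1)%N by rewrite ltnS leq_addr.
  rewrite (bigD1 (Ordinal lt_k)) //= addKn -/(lead_coef m) (monicP m_monic).
  rewrite divff // mulr1 vunitD ?val_one // rpred_sum // => l l_k.
  have [lt_kl|] := ltnP k l; first by rewrite vmaxMr ?s_max ?(polyOverP m_ring).
  rewrite leq_eqVlt => /orP[/eqP lk|lt_lk].
    by case/eqP: l_k; apply: val_inj.
  rewrite [m`__]nth_default ?mulr0 ?rpred0 //.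
  have m0 : (0 < size m)%N by rewrite size_poly_gt0 monic_neq0.
  by rewrite -(prednK m0) -/d ltn_subRL ltn_add2r.
(* The index [k + d] exceeds [h], so this coefficient lies in [vmax], and
   [s]_k[with it. All coefficients of]s * m[are integral multiples of]s[_k], against the unit at
   index [h]. *)
have sk_max : s`_k \in vmax v.
  apply: (vmax_unit km); rewrite mulrC -smE sm_max //.
  exact: leq_trans lt_hm (leq_addl _ _).
case/negP: (vunit_vmax smh); rewrite smE vmaxMr // rpred_sum // => l _.
by rewrite rpredM ?s_ring ?(polyOverP m_ring).
Qed.

End DegreeBound.

(** * Simple extensions of henselian fields *)

(*BEGIN*)
Definition simple_extension (T F : fieldType) (j : {rmorphism T -> F}) (y : F) :
  set F := [set (map_poly j g).[y] | g in [set: {poly T}]].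

Lemma range_simple_extension (T F : fieldType) (j : {rmorphism T -> F})
    (y : F) :
  range j `<=` simple_extension j y.
Proof. by move=> _ [t _ <-]; exists t%:P; rewrite ?map_polyC ?hornerC. Qed.

Lemma gen_simple_extension (T F : fieldType) (j : {rmorphism T -> F}) (y : F) :
  simple_extension j y y.
Proof. by exists 'X; rewrite ?map_polyX ?hornerX. Qed.

(** Write [m = s * d] with [d] the gcd. As [d] divides [g], it does not vanish at [y], so [s] does;
    then [m] divides [s] and [d] is constant. *)
Lemma minpoly_coprime (T F : fieldType) (j : {rmorphism T -> F}) (y : F) m g :
  is_minpoly (j := j) y m -> ~~ root (map_poly j g) y -> coprimep m g.
Proof.
move=> m_y g_y; have [m_monic my] := m_y.
have m0 := monic_neq0 m_monic.
have [s mE] := dvdpP _ _ (dvdp_gcdl m g); set d := gcdp m g in mE *.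
have s0 : s != 0 by apply: contraTneq m0 => s0; rewrite mE s0 mul0r eqxx.
have d0 : d != 0 by apply: contraTneq m0 => d0; rewrite mE d0 mulr0 eqxx.
have : root (map_poly j m) y by apply: minpoly_root.
rewrite {1}mE rmorphM rootM => /orP[|d_y]; last first.
  by case/negP: g_y; rewrite my; apply: dvdp_trans (dvdp_gcdr m g); rewrite -my.
rewrite my => /(dvdp_leq s0); rewrite {1}mE size_mul // /coprimep -/d.
move: d0 s0; rewrite -!size_poly_gt0; case: (size s) (size d) =>
  [|a] [|[|b]] //.
by move=> _ _; rewrite addnS /= -[X in (_ <= X)%N]addn0 leq_add2l.
Qed.

(** A Bezout relation between [m] and [b], evaluated at [y], inverts a nonzero value of [b]. *)
Lemma simple_extension_subfield (T F : fieldType) (j : {rmorphism T -> F})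
    (y : F) m :
  is_minpoly (j := j) y m -> subfield (simple_extension j y).
Proof.
move=> m_y; split; first by apply/mem_set; exists 1; rewrite ?rmorph1 ?hornerC.
- move=> _ _ /set_mem[a _ <-] /set_mem[b _ <-]; apply/mem_set.
  by exists (a - b); rewrite ?rmorphB ?hornerD ?hornerN.
- move=> _ _ /set_mem[a _ <-] /set_mem[b _ <-]; apply/mem_set.
  (* Division by zero yields zero, so closure under quotients also covers this case. *)
  have [/rootP->|b_y] := boolP (root (map_poly j b) y).
    by exists 0; rewrite ?rmorph0 ?horner0 ?invr0 ?mulr0.
  have /Bezout_eq1_coprimepP[[u w] /= uw] := minpoly_coprime m_y b_y.
  exists (a * w) => //; rewrite rmorphM hornerM; congr (_ * _).
  have := congr1 (fun p => (map_poly j p).[y]) uw.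
  rewrite rmorphD !rmorphM rmorph1 hornerD !hornerM hornerC.
  rewrite (rootP (minpoly_root m_y)) mulr0 add0r => wb.
  by apply: (mulIf b_y); rewrite wb mulVf.
Qed.

(** Existence comes from the remainder modulo [m]. Two representations differ by a multiple of [m]
    of smaller size, which is zero. *)
Lemma simple_extension_reduce (T F : fieldType) (j : {rmorphism T -> F})
    (y : F) m z :
    is_minpoly (j := j) y m -> simple_extension j y z ->
  exists! a : {ffun 'I_(size m).-1 -> F},
    (forall i, range j (a i)) /\ z = \sum_i a i * y ^+ i.
Proof.
move=> m_y [g _ <-]; have [m_monic my] := m_y.
have m_gt0 : (0 < size m)%N by rewrite size_poly_gt0 monic_neq0.
have ysum (q : {poly T}) : (size q <= (size m).-1)%N ->
    (map_poly j q).[y] = \sum_(i < (size m).-1) j q`_i * y ^+ i.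
  move=> le_qm; rewrite (@horner_coef_wide _ (size m).-1) ?size_map_poly //.
  by apply: eq_bigr => i _; rewrite coef_map.
pose q := g %% m.
have le_qm : (size q <= (size m).-1)%N
  by rewrite -ltnS prednK // ltn_modp monic_neq0.
have gq : (map_poly j g).[y] = (map_poly j q).[y].
  rewrite {1}(divp_eq g m) rmorphD rmorphM hornerD hornerM.
  by rewrite (rootP (minpoly_root m_y)) mulr0 add0r.
exists [ffun i : 'I_(size m).-1 => j q`_i]; split.
  split; first by move=> i; rewrite ffunE; exists q`_i.
  by rewrite gq ysum //; apply: eq_bigr => i _; rewrite ffunE.
move=> a [aj aE]; apply/ffunP => i; rewrite ffunE.
have {}aj l : exists t, j t = a l by case: (aj l) => t; exists t.
have [c cE] := boolp.choice aj.
(* [insub] turns [k] into an ordinal; below the bound it succeeds, so the default 0 is never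
   taken. *)
pose qa := \poly_(k < (size m).-1) (if insub k is Some l then c l else 0).
have qaE (l : 'I_(size m).-1) : qa`_l = c l by rewrite coef_poly ltn_ord valK.
have le_qa : (size qa <= (size m).-1)%N by apply: size_poly.
suff qqa : q - qa = 0 by rewrite (subr0_eq qqa) qaE cE.
have : root (map_poly j (q - qa)) y.
  rewrite /root rmorphB hornerD hornerN -gq aE ysum // subr_eq0; apply/eqP.
  by apply: eq_bigr => l _; rewrite qaE cE.
rewrite my => m_qqa; apply/eqP/negPn/negP => qqa0.
have := dvdp_leq qqa0 m_qqa; rewrite leqNgt => /negP[].
rewrite -(prednK m_gt0) ltnS (leq_trans (size_polyD _ _)) // size_polyN.
by rewrite geq_max le_qm.
Qed.

Section Transfer.
Context {F : closedFieldType} {G : orderedGroup} {v : valuation F G}.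
Context {T : fieldType} {j : {rmorphism T -> F}}.
Hypothesis hensel : henselian v (range j).

(* A root b in F of a Hensel problem over T(y) is unique in its residue class;
   its conjugates over T(y) lie in the same class because the value of b - a
   equals the value of its conjugates over T, so b has no other conjugate. *)
Lemma henselian_simple_extension (y : F) :
  integralOver j y -> henselian v (simple_extension j y).
Proof.
move=> y_int; have [m m_y] : exists m, is_minpoly (j := j) y m.
  by apply: minpoly_exists; case: y_int => p p_monic; exists p;
    rewrite ?monic_neq0.
have [T' [j' j'E]] := subfield_range (simple_extension_subfield m_y).
have int_E z : simple_extension j y z -> integralOver j z.
  move=> [g _ <-]; apply: integral_horner y_int => c.
  by move=> /(nthP 0)[i _ <-]; rewrite coef_map; apply: integral_id.
move=> p a pE Ea a_ring pa p'a.
have p_ring : p \is a polyOver (vring v) by apply/polyOverP => i; case: (pE i).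
have [b pb b_a] := hensel_root_exists pa p'a.
exists b; split=> //; rewrite j'E.
have [p' p'E] : exists p', p = map_poly j' p'.
  by apply: map_poly_lift => i; rewrite -j'E; case: (pE i).
have p0 : p' != 0.
  by apply: contraTneq (vunit_neq0 p'a) => p'0;
    rewrite p'E p'0 rmorph0 derivC horner0 eqxx.
have [|mu mu_b] := @minpoly_exists _ _ j' b; first by exists p'; rewrite -?p'E.
have [mu_monic mub] := mu_b.
have [a' _ a'E] : range j' a by rewrite -j'E.
have b_int : integralOver j b.
  apply: (@integral_root_monic _ _ _ _ (map_poly j' mu)).
  - by rewrite map_monic.
  - exact: minpoly_root.
  - apply/integral_poly => i; apply: int_E; rewrite j'E; apply: map_poly_range.
have [pi pi_ba] : exists pi, is_minpoly (j := j) (b - a) pi.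
  apply: minpoly_exists; apply/integral_algebraic.
  by apply: integral_sub => //; apply: int_E.
have [pi' pi'E] : exists pi', map_poly j pi = map_poly j' pi'.
  apply: map_poly_lift => i; rewrite -j'E; apply: range_simple_extension.
  exact: map_poly_range.
(* [pi] shifted by [a] has coefficients in the simple extension and vanishes at [b], so [mu] divides
   it. Hence [z - a] is a conjugate of [b - a] over [T]. *)
have mu_near z : root (map_poly j' mu) z -> z - a \in vmax v.
  move=> mu_z; rewrite inE -(val_conj hensel pi_ba) //.
  have shift w : root (map_poly j' (pi' \Po ('X - a'%:P))) w =
                 root (map_poly j pi) (w - a).
    rewrite map_comp_poly /root horner_comp -pi'E map_polyXsubC a'E.
    by rewrite hornerXsubC.
  rewrite -shift; have := minpoly_root pi_ba; rewrite -shift mub.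
  by move=> /dvdpP[w ->]; rewrite rmorphM rootM mu_z orbT.
have := pb; rewrite p'E mub => /dvdpP[w p'w].
have p_mu : p = map_poly j' w * map_poly j' mu by rewrite p'E p'w rmorphM.
have [r mu_r] := closed_field_poly_normal (map_poly j' mu).
rewrite lead_coef_map (monicP mu_monic) rmorph1 scale1r in mu_r.
have br : b \in r by rewrite -root_prod_XsubC -mu_r; apply: minpoly_root.
have {mu_r} : map_poly j' mu = ('X - b%:P) * \prod_(z <- rem b r) ('X - z%:P).
  by rewrite mu_r (perm_big _ (perm_to_rem br)) /= big_cons.
case: (rem b r) => [|z r'] mu_r.
  exists (- mu`_0) => //; rewrite rmorphN -coef_map mu_r big_nil mulr1.
  by rewrite coefB coefX coefC /= sub0r opprK.
have zb : z = b.
  have mu_z : root (map_poly j' mu) z.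
    by rewrite mu_r rootM root_prod_XsubC mem_head orbT.
  have pz : root p z by rewrite p_mu rootM mu_z orbT.
  exact: hensel_root_unique p_ring a_ring p'a pz (mu_near z mu_z) pb b_a.
(* A second factor ['X - b%:P] in [mu] would make [b] a multiple root of [p], whose derivative at
   [b] is a unit. *)
have := vunit_neq0 (vunit_deriv_near p_ring a_ring b_a p'a).
rewrite p_mu mu_r big_cons zb mulrCA.
by rewrite derivM derivXsubC !hornerE subrr /= !(mul0r, mulr0, add0r) eqxx.
Qed.

End Transfer.

(** * Henselizations and approximation types *)

(*BEGIN*)
Section Henselization.
Context {F : closedFieldType} {G : orderedGroup} {v : valuation F G}.

Lemma henselization_sub (E : set F) : E `<=` henselization v E.
Proof. exact: sub_gen_smallest. Qed.

Lemma henselization_min (E H : set F) :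
  subfield H -> henselian v H -> E `<=` H -> henselization v E `<=` H.
Proof. by move=> sH hH; apply: smallest_sub. Qed.

Lemma henselization_subfield (E : set F) : subfield (henselization v E).
Proof.
split; first by apply/mem_set => H [[[H1 _ _] _] _]; apply: set_mem.
- move=> a b /set_mem aE /set_mem bE; apply/mem_set => H HE.
  have [[[_ HB _] _] _] := HE.
  by apply: set_mem; apply: HB; apply: mem_set; [apply: aE | apply: bE].
- move=> a b /set_mem aE /set_mem bE; apply/mem_set => H HE.
  have [[[_ _ HD] _] _] := HE.
  by apply: set_mem; apply: HD; apply: mem_set; [apply: aE | apply: bE].
Qed.

(** The root found in the algebraically closed field is unique in its residue class, so it lies in
    every henselian subfield of the intersection. *)
Lemma henselization_henselian (E : set F) : henselian v (henselization v E).
Proof.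
move=> p a pE aE a_ring pa p'a.
have p_ring : p \is a polyOver (vring v) by apply/polyOverP => i; case: (pE i).
have [b pb b_a] := hensel_root_exists pa p'a.
exists b; split=> // H HE; have [[_ hH] _] := HE.
have [||b' [b'H pb' b'_a]] := hH p a _ _ a_ring pa p'a.
- by move=> i; case: (pE i) => piE pi_ring; split=> //; apply: piE.
- exact: aE.
by rewrite (hensel_root_unique p_ring a_ring p'a pb b_a pb' b'_a).
Qed.

Lemma val_exp (a : F) n : v (a ^+ n) = v a *+ n.
Proof. by elim: n => [|n IH]; rewrite ?expr0 ?val_one //
  exprS valuationM IH mulrS. Qed.

End Henselization.

(** * Elements close to [x] *)

Section Near.
Context {K L : fieldType} {G : orderedGroup}.
Context {iota : {rmorphism K -> L}} {v : valuation L G} {x : L}.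

Lemma eventually_near_and (phi psi : K -> Prop) :
  eventually_near iota v x phi -> eventually_near iota v x psi ->
  eventually_near iota v x (fun c => phi c /\ psi c).
Proof.
move=> [a [va a0 phia]] [b [vb b0 psib]].
have [le_ab|lt_ba] := leP a b.
  exists b; split=> // c bc; split; last exact: psib.
  by apply: phia; apply: le_trans le_ab bc.
exists a; split=> // c ac; split; first exact: phia.
by apply: psib; apply: le_trans (ltW lt_ba) ac.
Qed.

(** [psi] provides a nonempty neighbourhood when [n] is 0, where the induction starts. *)
Lemma eventually_near_all (n : nat) (phi : nat -> K -> Prop) (psi : K -> Prop) :
  eventually_near iota v x psi ->
  (forall i, (1 <= i <= n)%N -> eventually_near iota v x (phi i)) ->
  eventually_near iota v x
    (fun c => psi c /\ forall i, (1 <= i <= n)%N -> phi i c).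
Proof.
move=> psiP; elim: n => [|n IH] phiP.
  by case: psiP => a [va a0 psia]; exists a; split=> // c /psia; split=> // -[].
have [i /andP[i0 le_in]||a [va a0 phia]] := eventually_near_and (IH _) (phiP
  n.+1 _).
- by apply: phiP; rewrite i0 leqW.
- by rewrite ltnS leqnn.
exists a; split=> // c /phia[[psic phic] phin]; split=> // i /andP[i0].
by rewrite leq_eqVlt => /predU1P[->|lt_in] //; apply: phic; rewrite i0.
Qed.

Lemma eventually_near_ex (phi : K -> Prop) :
  eventually_near iota v x phi -> exists c, phi c.
Proof. by case=> a [_ [c ac] phia]; exists c; apply: phia. Qed.

(** By immediacy some [c'] is strictly closer to [x] than [c]; then [c' - c] has the value of
    [x - c]. *)
Lemma appr_immediate_unit (c : K) : appr_immediate iota v x ->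
  exists2 a, iota a != 0 & v ((x - iota c) / iota a) = 0.
Proof.
move=> x_imm; have [al [_ [c' al_c']] al_c] :
    exists2 al, appr_support iota v x al & ~ appr iota v x al c.
  apply: contrapT => no_al.
  suff : set0 c by [].
  rewrite -x_imm => al al_supp; apply: contrapT => al_c.
  by apply: no_al; exists al.
have lt_cc' : v (x - iota c) < v (x - iota c').
  by apply: lt_le_trans al_c'; rewrite ltNge; apply/negP.
have xc0 : x - iota c != 0.
  rewrite -(val_neq_infty v); apply: contraTneq lt_cc' => ->.
  by rewrite -leNgt; case: (v _).
have unit_a : v (iota (c' - c) / (x - iota c)) = 0.
  have -> : iota (c' - c) / (x - iota c) = 1 - (x - iota c') / (x - iota c).
    rewrite -(divff xc0) -mulrBl rmorphB; congr (_ / _).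
    by rewrite opprB [RHS]addrC subrKA.
  by rewrite vunitD ?val_one // rpredN -lt_val_div.
exists (c' - c); last by rewrite -invf_div; apply: vunitV.
by apply: contraTneq (vunit_neq0 unit_a) => ->; rewrite mul0r eqxx.
Qed.

End Near.

Lemma nderivn_lead (R : nzRingType) (f : {poly R}) :
  f^`N((size f).-1) = (lead_coef f)%:P.
Proof.
apply/polyP => i; rewrite coef_nderivn coefC; case: i => [|i] /=.
  by rewrite addn0 binn.
rewrite nth_default ?mul0rn // addnS; case: (size f) => // n.
by rewrite ltnS leq_addr.
Qed.

(** * The degree of the extension of henselizations *)

Theorem theorem9p1 (K : fieldType) (Omega : closedFieldType)
    (iota : {rmorphism K -> Omega}) (G : orderedGroup)
    (v : valuation Omega G) (x : Omega)
    (Omega_alg : algebraic_over (adjoin iota x))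
    (x_imm : appr_immediate iota v x)
    (d : option nat) (x_deg : is_appr_degree iota v x d)
    (f : {poly K}) (f_nonconst : (1 <= (size f).-1)%N)
    (f_deg : if d is Some n then ((size f).-1 <= n)%N else true)
    (h : nat) (f_rel : is_rel_appr_degree iota v x f h) :
  exists m : nat,
    extension_degree
      (henselization v (adjoin iota (map_poly iota f).[x]))
      (henselization v (adjoin iota x)) m /\
    (m <= h)%N.
Proof.
case: f_rel => beta [betaP /andP[h_gt0 le_hn] h_near].
set z := (map_poly iota f).[x]; set n := (size f).-1 in betaP le_hn h_near.
have [c [h_lt fc]] := eventually_near_ex (eventually_near_all h_near
  (fun i iP => (betaP i iP).2)).
have [a a0 y_unit] := appr_immediate_unit c x_imm.
set y := (x - iota c) / iota a in y_unit.
have xE : x = iota c + iota a * y by rewrite /y mulrC divfK // addrC subrK.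
set H := henselization v (adjoin iota z);
  set L := henselization v (adjoin iota x).
have iota_adjoin w : range iota `<=` adjoin iota w.
  by apply: subset_trans (@sub_gen_smallest _ _ _); apply: subsetUl.
have gen_adjoin w : adjoin iota w w.
  by apply: (@sub_gen_smallest _ _ _); right.
have adjoin_min w (E : set Omega) :
    subfield E -> range iota `<=` E -> E w -> adjoin iota w `<=` E.
  by move=> sE iE wE; apply: smallest_sub => // u [/iE|->].
have [T [j jH]] : exists (T : fieldType) (j : {rmorphism T -> Omega}), H =
  range j.
  exact/subfield_range/henselization_subfield.
have hensel : henselian v (range j) by rewrite -jH;
  apply: henselization_henselian.
have iotaj t : iota t \in rangep j.
  apply/rangepP; rewrite -jH; apply: henselization_sub; apply: iota_adjoin.
  by exists t.
have zj : z \in rangep j.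
  by apply/rangepP; rewrite -jH; apply: henselization_sub; apply: gen_adjoin.
(* Taylor expansion of f at c, rescaled by a *)
pose t i := iota (f^`N(i)).[c] * iota a ^+ i.
have t_val i : (1 <= i <= n)%N -> v (t i) = beta i + v (x - iota c) *+ i.
  by move=> iP; rewrite valuationM (fc i iP) val_exp; congr (_ + _ *+ _);
     apply/eq_val_div.
have t_lt i : (1 <= i <= n)%N -> i != h -> v (t h) < v (t i).
  by move=> iP i_h; rewrite !t_val ?h_gt0 ?le_hn //; apply: h_lt.
(* For [h = n] this is a multiple of the leading coefficient of [f]; otherwise its value lies
   strictly below that of [t n], hence is finite. *)
have th0 : t h != 0.
  have [->|h_n] := eqVneq h n.
    rewrite /t nderivn_lead hornerC mulf_neq0 ?expf_neq0 //
      fmorph_eq0 lead_coef_eq0.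
    by rewrite -size_poly_gt0; case: (size f) f_nonconst.
  rewrite -(val_neq_infty v); apply: contraTneq (t_lt n _ _) => [->||].
  - by rewrite -leNgt; case: (v _).
  - by rewrite leqnn andbT.
  - by rewrite eq_sym.
pose g := (t h)^-1 *: (\poly_(i < n.+1) t i - z%:P).
have size_f : size f = n.+1 by rewrite /n; case: (size f) f_nonconst.
have gy : root g y.
  rewrite /root hornerZ hornerD hornerN hornerC mulf_eq0 subr_eq0; apply/orP;
    right.
  rewrite horner_poly /z [in X in _ == X]xE nderiv_taylor; last exact: mulrC.
  rewrite size_map_poly size_f; apply/eqP/eq_bigr => i _.
  by rewrite /t nderivn_map horner_map -mulrA -exprMn.
have tj i : t i \in rangep j by rewrite /t rpredM // rpredX.
have gj i : g`_i \in rangep j.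
  rewrite coefZ coefB coef_poly coefC rpredM ?rpredV ?rpredB //.
    by case: ifP => _; rewrite ?rpred0.
  by case: ifP => _; rewrite ?rpred0.
(* Since [h] is positive, the constant [z] does not enter this coefficient. *)
have gh : g`_h = 1.
  rewrite coefZ coefB coef_poly coefC ltnS le_hn; case: eqP h_gt0 => [->//|_ _].
  by rewrite subr0 mulVf.
have g_max i : (h < i)%N -> g`_i \in vmax v.
  move=> lt_hi; rewrite coefZ coefB coef_poly coefC.
  have i_gt0 : (0 < i)%N by apply: leq_ltn_trans lt_hi.
  rewrite gtn_eqF // subr0; case: ltnP => [le_in|_]; last by
    rewrite mulr0 rpred0.
  by rewrite mulrC -lt_val_div // t_lt ?i_gt0 // gtn_eqF.
have [g' g'E] : exists g', g = map_poly j g'.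
  by apply: map_poly_lift => i; apply/rangepP.
have [|m m_y] := @minpoly_exists _ _ j y.
  exists g'; rewrite -?g'E //; apply: contraTneq (oner_neq0 Omega) => g'0.
  by rewrite -gh g'E g'0 rmorph0 coef0 eqxx.
have [m_monic my] := m_y.
have m_ring : map_poly j m \is a polyOver (vring v).
  have [r m_r] := closed_field_poly_normal (map_poly j m).
  rewrite m_r lead_coef_map (monicP m_monic) rmorph1 scale1r big_seq
    rpred_prod //.
  move=> w wr; rewrite polyOverXsubC vunit_vring // -(val_conj hensel m_y) //.
  rewrite m_r lead_coef_map (monicP m_monic) rmorph1 scale1r.
  by rewrite root_prod_XsubC.
(* The simple extension is henselian and contains [x = c + a y]. Conversely [L] is henselian and
   contains [f(x)], hence [H], and it contains [y]. *)
have L_eq : L = simple_extension j y.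
  apply/seteqP; split=> [|_ [w _ <-]].
    have sE := simple_extension_subfield m_y.
    apply: henselization_min => //.
      apply: henselian_simple_extension => //; apply/integral_algebraic.
      by exists m; rewrite ?monic_neq0 // minpoly_root.
    have [T' [j' j'E]] := subfield_range sE.
    have iotaE t0 : iota t0 \in rangep j'.
      by apply/rangepP; rewrite -j'E; apply: range_simple_extension;
        apply/rangepP.
    apply: adjoin_min => // [_ [t0 _ <-]|]; rewrite j'E; first exact/rangepP.
    apply/rangepP; rewrite xE; apply: rpredD => //; apply: rpredM => //.
    by apply/rangepP; rewrite -j'E; apply: gen_simple_extension.
  have [T' [j' j'E]] := subfield_range (henselization_subfield (v := v)
    (adjoin iota x)).
  have iotaE t0 : iota t0 \in rangep j'.
    apply/rangepP; rewrite -j'E; apply: henselization_sub; apply: iota_adjoin.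
    by exists t0.
  have xL : x \in rangep j'.
    by apply/rangepP; rewrite -j'E; apply: henselization_sub; apply: gen_adjoin.
  have sub_jj' u : j u \in rangep j'.
    apply/rangepP; rewrite -j'E;
      apply: (henselization_min (E := adjoin iota z)).
    - exact: henselization_subfield.
    - exact: henselization_henselian.
    - apply: adjoin_min; rewrite j'E; first exact: range_subfield.
        by move=> _ [t0 _ <-]; apply/rangepP.
      apply/rangepP; rewrite rpred_horner //; apply/polyOverP => i.
      by rewrite coef_map; apply: iotaE.
    - by change (H (j u)); rewrite jH; exists u.
  rewrite /L j'E; apply/rangepP; rewrite rpred_horner //.
    by apply/polyOverP => i; rewrite coef_map; apply: sub_jj'.
  by rewrite rpred_div // rpredB.
exists (size m).-1; split.
  exists (fun i => y ^+ i); split=> [i|w].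
    rewrite L_eq; exists 'X^i; rewrite ?map_polyXn ?hornerXn //.
  by rewrite L_eq jH; apply: simple_extension_reduce.
(* Over [T], [g] is a multiple of [m], and its last unit coefficient has index [h]. *)
have := gy; rewrite g'E my => /dvdpP[s g's].
rewrite -(size_map_poly j);
  apply: (vunit_coef_degree (v := v) (s := map_poly j s)) => //.
- by rewrite map_monic.
- by rewrite -rmorphM -g's /= -g'E gh val_one.
- by move=> i /g_max; rewrite g'E g's rmorphM.
Qed.
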